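(* Let $M$ be a topological manifold. Suppose that a subgroup $G\subset\mathrm{Homeo}(M)$ has the local perturbations property and that $\tau$ is a separable, metrizable group topology on $G$. Then for any open set $U\subset M$, any point $y\in U$, and any open neighborhood $N$ of the identity in $(G,\tau)$, there exists $f\in N$ such that $f(y)\neq y$ and $f|_{M\setminus U}=\mathrm{id}$.
   Context: $\mathrm{Homeo}(M)$ is the group of all homeomorphisms of $M$. A subgroup $G\subset\mathrm{Homeo}(M)$ satisfies the local perturbations property if for each open set $U\subset M$ and each point $y\in U$, the set $\{f(y) : f\in G,\ f|_{M\setminus U}=\mathrm{id}\}$ is uncountable. A group topology on $G$ is a topology making multiplication and inversion continuous. *)

(* Defs.v *)
From HB Require Import structures.
From mathcomp Require Import all_boot all_order all_algebra.
From mathcomp Require Import all_classical all_reals all_analysis.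
Set Implicit Arguments.
Unset Strict Implicit.
Unset Printing Implicit Defensive.
Import numFieldNormedType.Exports.
Local Open Scope classical_set_scope.

(* [phi] and [psi] are mutually inverse homeomorphisms between [U] and [V];
   their values outside [U] and [V] are irrelevant. *)
Definition locally_euclidean (R : realType) (n : nat) (M : topologicalType) :=
  forall x : M, exists (U : set M) (V : set 'rV[R]_n)
      (phi : M -> 'rV[R]_n) (psi : 'rV[R]_n -> M),
    [/\ open U, U x & open V] /\
    [/\ set_fun U V phi, set_fun V U psi,
        (forall z, U z -> psi (phi z) = z) &
        (forall v, V v -> phi (psi v) = v)] /\
    {within U, continuous phi} /\ {within V, continuous psi}.

Definition topological_manifold (R : realType) (n : nat) (M : topologicalType) :=
  [/\ hausdorff_space M, @second_countable M & locally_euclidean R n M].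

Record homeo (M : topologicalType) := Homeo {
  homeo_fun :> M -> M;
  homeo_inv : M -> M;
  homeo_funK : cancel homeo_fun homeo_inv;
  homeo_invK : cancel homeo_inv homeo_fun;
  homeo_fun_continuous : continuous homeo_fun;
  homeo_inv_continuous : continuous homeo_inv }.

Section HomeoGroup.
Variable M : topologicalType.
Implicit Types f g h : homeo M.

Lemma homeo_eq f g : f =1 g -> f = g.
Proof.
case: f g => [f f' fK f'K cf cf'] [g g' gK g'K cg cg'] /= /funext fg.
subst g.
have f'g' : f' = g' by apply/funext => x; rewrite -[LHS]gK f'K.
subst g'.
by congr Homeo; exact: Prop_irrelevance.
Qed.

HB.instance Definition _ := gen_eqMixin (homeo M).
HB.instance Definition _ := gen_choiceMixin (homeo M).

Definition homeo_id : homeo M :=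
  @Homeo M id id (fun _ => erefl) (fun _ => erefl)
    (fun x => @cvg_id _ (nbhs x)) (fun x => @cvg_id _ (nbhs x)).

Definition homeo_sym f : homeo M :=
  Homeo (@homeo_invK M f) (@homeo_funK M f)
    (@homeo_inv_continuous M f) (@homeo_fun_continuous M f).

Definition homeo_comp f g : homeo M :=
  Homeo (can_comp (@homeo_funK M f) (@homeo_funK M g))
    (can_comp (@homeo_invK M g) (@homeo_invK M f))
    (fun x => continuous_comp (@homeo_fun_continuous M g x)
       (@homeo_fun_continuous M f (g x)))
    (fun x => continuous_comp (@homeo_inv_continuous M f x)
       (@homeo_inv_continuous M g (homeo_inv f x))).

Lemma homeo_compA : associative homeo_comp.
Proof. by move=> f g h; exact: homeo_eq. Qed.

Lemma homeo_comp1f : left_id homeo_id homeo_comp.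
Proof. by move=> f; exact: homeo_eq. Qed.

Lemma homeo_compf1 : right_id homeo_id homeo_comp.
Proof. by move=> f; exact: homeo_eq. Qed.

Lemma homeo_compVf : left_inverse homeo_id homeo_sym homeo_comp.
Proof. by move=> f; apply: homeo_eq => x /=; rewrite homeo_funK. Qed.

Lemma homeo_compfV : right_inverse homeo_id homeo_sym homeo_comp.
Proof. by move=> f; apply: homeo_eq => x /=; rewrite homeo_invK. Qed.

HB.instance Definition _ := isGroup.Build (homeo M)
  homeo_compA homeo_comp1f homeo_compf1 homeo_compVf homeo_compfV.

End HomeoGroup.

Definition subgroup_type (gT : groupType) (G : groupClosed gT) : Type :=
  {x : gT | x \in G}.

Section SubgroupType.
Variables (gT : groupType) (G : groupClosed gT).

HB.instance Definition _ := SubChoice.on (subgroup_type G).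

Fact subgroup_type_closed : group_closed (fun x : gT => x \in G).
Proof. by split=> [|x y]; [exact: gpred1 | exact: gpredF]. Qed.

HB.instance Definition _ :=
  SubChoice_isSubGroup.Build gT (fun x : gT => x \in G) (subgroup_type G)
    subgroup_type_closed.

End SubgroupType.

(* A topology on a group is a class instance [tau : Topological gT], so that
   the carrier of [Topological.Pack tau] is the group itself.  The choice
   structure contained in [tau] plays no role. *)
Definition group_topology (gT : groupType) (tau : Topological gT) :=
  let T : topologicalType := Topological.Pack tau in
  continuous (fun p : T * T => (p.1 : gT) * (p.2 : gT) : T)%g /\
  continuous (fun x : T => (x : gT)^-1 : T)%g.

Definition separable (T : topologicalType) :=
  exists2 D : set T, countable D & dense D.

(* The metric structure [d] carries its own topology, which has to coincide
   with the given one. *)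
Definition metrizable (R : realType) (T : topologicalType) :=
  exists d : Metric R T, @open (Metric.Pack d) = @open T.

Definition identity_outside (M : Type) (U : set M) (f : M -> M) :=
  forall x, ~ U x -> f x = x.

Definition local_perturbations (M : topologicalType)
    (G : groupClosed (homeo M)) :=
  forall (U : set M) (y : M), open U -> U y ->
    ~ countable [set f y | f in [set f : homeo M |
                                  f \in G /\ identity_outside U f]].

(* Main.v *)
Require Import Defs.
From HB Require Import structures.
From mathcomp Require Import all_boot all_order all_algebra.
From mathcomp Require Import all_classical all_reals all_analysis.
Local Open Scope classical_set_scope.

(** The elements of [G] supported in [U] move [y] to uncountably many points.
    A separable group is covered by countably many translates of any
    neighbourhood of the identity, so two such elements [h] and [k] lying in a
    common small translate must send [y] to different points
    ([separable_group_close_pair]); then [h^-1 k] is close to the identity, is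
    supported in [U], and moves [y]. *)

Section GroupTopology.
Variables (gT : groupType) (tau : Topological gT).
Let T : topologicalType := Topological.Pack tau.
Hypothesis tauG : group_topology tau.

Lemma continuous_mulg (S : topologicalType) (a b : S -> T) :
  continuous a -> continuous b ->
  continuous (fun s => (a s : gT) * (b s : gT) : T)%g.
Proof.
move=> ca cb s.
have cab : {for s, continuous (fun s => (a s, b s) : T * T)}.
  by apply: cvg_pair; [exact: ca | exact: cb].
exact: continuous_comp cab (tauG.1 _).
Qed.

Lemma nbhs1_divg (N : set T) : nbhs (1%g : T) N ->
  exists2 W : set T, open W /\ W 1%g &
    forall a b : gT, W a -> W b -> N (a * b^-1)%g.
Proof.
move=> N1.
have divc : continuous (fun p : T * T => (p.1 : gT) * (p.2 : gT)^-1 : T)%g.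
  apply: continuous_mulg => p; first exact: cvg_fst.
  by apply: continuous_comp (tauG.2 _); exact: cvg_snd.
have : nbhs ((fun p : T * T => (p.1 : gT) * (p.2 : gT)^-1 : T)%g
             ((1%g : T), (1%g : T))) N by rewrite /= invg1 mulg1.
move=> /(divc ((1%g : T), (1%g : T))) [[A B] /= [A1 B1] AB].
exists (interior (A `&` B)).
  by split; [exact: open_interior | exact: filterI].
move=> a b /interior_subset[Aa _] /interior_subset[_ Bb].
exact: (AB (a, b)).
Qed.

(** Choose an open [W] around the identity with [W W^-1] inside [N], and label
    each [h] by a point [d] of the countable dense set in the open set [h W].
    If [h] and [k] have the same label [d], then
    [h^-1 k = (h^-1 d) (k^-1 d)^-1] lies in [W W^-1].  Were [phi] constant on
    the elements with a given label, it would take at most one value for each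
    of the countably many labels. *)
Lemma separable_group_close_pair (X : Type) (phi : gT -> X) (H : set gT)
    (N : set T) :
  separable T -> nbhs (1%g : T) N -> ~ countable (phi @` H) ->
  exists h k : gT, [/\ H h, H k, N (h^-1 * k)%g & phi h <> phi k].
Proof.
move=> [D Dcount Ddense] N1 Huncount; apply: contrapT => noPair.
apply: Huncount.
have [W [Wo W1] WN] := nbhs1_divg N N1.
have label h : exists2 d : gT, D d & W (h^-1 * d)%g.
  have hWo : open ((fun d : T => (h^-1 * (d : gT))%g : T) @^-1` W).
    apply: open_comp => // d _.
    by apply: (continuous_mulg T (fun=> h^-1%g) id) => x;
      [exact: cvg_cst | exact: cvg_id].
  have [|d [Wd Dd]] := Ddense _ _ hWo; last by exists d.
  by exists h; rewrite /preimage /= mulVg.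
apply: (@sub_countable _ _ _ (\bigcup_(d in D)
    (phi @` [set h | H h /\ W (h^-1 * d)%g]))).
  apply: subset_card_le => _ [h Hh <-]; have [d Dd Wd] := label h.
  by exists d => //; exists h.
apply: bigcup_countable => // d _.
have [[h0 [Hh0 Wh0]]|none] :=
    pselect (exists h, H h /\ W (h^-1 * d)%g); last first.
  apply: (@sub_countable _ _ _ (@set0 X)); last exact: countable0.
  by apply: subset_card_le => x [h Hh _]; case: none; exists h.
apply: (@sub_countable _ _ _ [set phi h0]); last exact: countable1.
apply: subset_card_le => _ [h [Hh Wh] <-] /=.
apply: contrapT => neq; apply: noPair; exists h, h0; split=> //.
by have := WN _ _ Wh Wh0; rewrite invgM invgK mulgA mulgK.
Qed.

End GroupTopology.

Theorem theorem2p3 (R : realType) (n : nat) (M : topologicalType)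
    (G : groupClosed (homeo M)) (tau : Topological (subgroup_type G)) :
  topological_manifold R n M ->
  local_perturbations G ->
  group_topology tau ->
  separable (Topological.Pack tau) ->
  metrizable R (Topological.Pack tau) ->
  forall (U : set M) (y : M) (N : set (subgroup_type G)),
    open U -> U y ->
    @open (Topological.Pack tau) N -> N 1%g ->
    exists f : subgroup_type G,
      [/\ N f, val f y <> y & identity_outside U (val f)].
Proof.
move=> _ Gpert tauG Gsep _ U y N Uo Uy No N1.
pose H := [set f : subgroup_type G | identity_outside U (val f)].
pose orb (f : subgroup_type G) := val f y.
have orbU : ~ countable (orb @` H).
  apply: contra_not (Gpert U y Uo Uy); apply: sub_countable.
  apply: subset_card_le => _ [f [Gf fU] <-].
  by exists (exist _ f Gf : subgroup_type G).
have [h [k [hU kU Nhk neq]]] :=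
  separable_group_close_pair _ tau tauG _ orb H N Gsep
    (open_nbhs_nbhs (conj No N1)) orbU.
exists (h^-1 * k)%g; split=> // [|x Ux].
  by move=> /(congr1 (val h)) /=; rewrite homeo_invK => /esym.
by rewrite /= (kU x Ux) -{1}(hU x Ux) homeo_funK.
Qed.
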